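(* Let $R$ be a ring. The class of $RD$-embeddings is cofibrantly generated in the category of left $R$-modules with $R$-homomorphisms; that is, there is a set $\mathcal{X}$ of morphisms such that the class of $RD$-embeddings is the class of morphisms generated from $\mathcal{X}$ by pushouts, transfinite composition and retracts.
   Context: Rings are associative with unity. An $R$-module embedding $f: A \to B$ is an $RD$-embedding if $f[A] \cap rB = r f[A]$ for every $r \in R$. ''Generated from $\mathcal{X}$ by pushouts, transfinite composition and retracts'' means the smallest class of morphisms containing $\mathcal{X}$ and closed under pushouts along arbitrary morphisms, transfinite compositions, and retracts in the arrow category. *)

(* Defs.v *)
From mathcomp Require Import all_boot all_algebra.
From mathcomp Require Import classical_sets wochoice.

Set Implicit Arguments.
Unset Strict Implicit.
Unset Printing Implicit Defensive.

Import GRing.Theory.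
Local Open Scope ring_scope.
Local Open Scope classical_set_scope.

(* The universe of sets, as opposed to proper classes. A bare [Type] in place of
   [small] would be a fresh universe, which could lie above that of [lmodType R]
   itself, and "is a set" would become vacuous. The next two definitions force
   [small] to be exactly the universe of the carriers of modules: carriers are
   small, and any small type may be a carrier. In particular [lmodType R] is not
   small. *)
Definition small := Type.

Definition small_of_lmod (R : pzRingType) (V : lmodType R) : small :=
  GRing.Lmodule.sort V.

Definition lmod_of_small (R : pzRingType) (V : small)
    (c : GRing.Lmodule.axioms_ R V) : lmodType R :=
  @GRing.Lmodule.Pack R V c.

Record arrow (R : pzRingType) := Arrow {
  dom : lmodType R;
  cod : lmodType R;
  arrow_map :> {linear dom -> cod} }.

Definition morphism_class (R : pzRingType) := arrow R -> Prop.

Definition is_small_class (R : pzRingType) (X : morphism_class R) : Prop :=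
  exists (I : small) (F : I -> arrow R), forall f, X f <-> exists i, F i = f.

Definition RD_embedding (R : pzRingType) : morphism_class R := fun f =>
  injective f /\
  forall r : R,
    range f `&` [set r *: b | b in [set: cod f]] = [set r *: y | y in range f].

(* The square
       A --f--> B
       |g       |h
       v        v
       C --k--> D   *)
Definition is_pushout (R : pzRingType) (A B C D : lmodType R)
    (f : {linear A -> B}) (g : {linear A -> C})
    (h : {linear B -> D}) (k : {linear C -> D}) : Prop :=
  h \o f =1 k \o g /\
  forall (Z : lmodType R) (u : {linear B -> Z}) (v : {linear C -> Z}),
    u \o f =1 v \o g ->
    exists2 w : {linear D -> Z}, w \o h =1 u /\ w \o k =1 v
      & forall w' : {linear D -> Z}, w' \o h =1 u -> w' \o k =1 v -> w' =1 w.

Definition closed_pushout (R : pzRingType) (K : morphism_class R) : Prop :=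
  forall (A B C D : lmodType R)
    (f : {linear A -> B}) (g : {linear A -> C})
    (h : {linear B -> D}) (k : {linear C -> D}),
    is_pushout f g h k -> K (Arrow f) -> K (Arrow k).

Definition is_retract (R : pzRingType) (f g : arrow R) : Prop :=
  exists (i : {linear dom f -> dom g}) (p : {linear dom g -> dom f})
         (j : {linear cod f -> cod g}) (q : {linear cod g -> cod f}),
    [/\ p \o i =1 id, q \o j =1 id, g \o i =1 j \o f & f \o p =1 q \o g].

Definition closed_retract (R : pzRingType) (K : morphism_class R) : Prop :=
  forall f g : arrow R, is_retract f g -> K g -> K f.

Section WellOrderedIndex.
Context (J : small) (le : rel J).

Definition below (i j : J) : bool := le i j && ~~ le j i.

Definition is_succ (i j : J) : Prop :=
  below i j /\ forall k, ~ (below i k /\ below k j).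

Definition is_limit (j : J) : Prop :=
  (exists i, below i j) /\ forall i, ~ is_succ i j.

End WellOrderedIndex.

Record chain_diagram (R : pzRingType) (J : small) (le : rel J) := ChainDiagram {
  obj : J -> lmodType R;
  link : forall i j, le i j -> {linear obj i -> obj j};
  link_id : forall i (ii : le i i), link ii =1 id;
  link_comp : forall i j k (ij : le i j) (jk : le j k) (ik : le i k),
    link jk \o link ij =1 link ik }.

(* [obj M j], with the links into it, is the colimit of the restriction of [M]
   to the indices strictly below [j]. *)
Definition colimit_at (R : pzRingType) (J : small) (le : rel J)
    (M : chain_diagram R le) (j : J) : Prop :=
  forall (Z : lmodType R) (c : forall i, below le i j -> {linear obj M i -> Z}),
    (forall i k (ij : below le i j) (kj : below le k j) (ik : le i k),
       c k kj \o link M ik =1 c i ij) ->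
    exists2 w : {linear obj M j -> Z},
        forall i (ij : below le i j) (ij' : le i j), w \o link M ij' =1 c i ij
      & forall w' : {linear obj M j -> Z},
          (forall i (ij : below le i j) (ij' : le i j),
             w' \o link M ij' =1 c i ij) ->
          w' =1 w.

Definition smooth (R : pzRingType) (J : small) (le : rel J)
    (M : chain_diagram R le) : Prop :=
  forall j, is_limit le j -> colimit_at M j.

(* A well-ordered set with greatest element has order type lambda + 1 for an
   ordinal lambda; the transfinite composition of the smooth chain
   (M_i | i <= lambda) is M_0 -> M_lambda. For lambda = 0 it is the identity. *)
Definition closed_transfinite_composition
    (R : pzRingType) (K : morphism_class R) : Prop :=
  forall (J : small) (le : rel J) (M : chain_diagram R le) (bot top : J)
    (bot_top : le bot top),
    well_order le -> (forall i, le bot i) -> (forall i, le i top) ->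
    smooth M ->
    (forall i j (ij : le i j), is_succ le i j -> K (Arrow (link M ij))) ->
    K (Arrow (link M bot_top)).

Definition generated (R : pzRingType) (X : morphism_class R) :
    morphism_class R := fun f =>
  forall K : morphism_class R,
    (forall g, X g -> K g) ->
    closed_pushout K -> closed_transfinite_composition K -> closed_retract K ->
    K f.

Definition cofibrantly_generated (R : pzRingType) (K : morphism_class R) : Prop :=
  exists X : morphism_class R,
    is_small_class X /\ forall f, K f <-> generated X f.

(* Main.v *)
Require Import Defs.
From HB Require Import structures.
From mathcomp Require Import all_boot all_algebra.
From mathcomp Require Import boolp classical_sets wochoice.

Set Implicit Arguments.
Unset Strict Implicit.
Unset Printing Implicit Defensive.

Import GRing.Theory.
Local Open Scope ring_scope.
Local Open Scope classical_set_scope.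
Local Open Scope quotient_scope.

(** A submodule M of V is RD in V when r V meets M exactly in r M, for every r.
    The generating set consists of RD-embeddings whose codomain is an image
    of one fixed set, the set of terms built from the ring: up to isomorphism
    there is only a set of these.

    Generated morphisms are RD-embeddings because RD-embeddings are closed under
    the three operations.  Being an RD-embedding is inherited by k from any
    composite w \o k ([RD_cancel]), so for a pushout or a colimit, known only by
    its universal property, it is enough to exhibit one cocone whose leg is an
    RD-embedding.  For pushouts this is the usual quotient of the direct sum;
    for limit stages of a chain it is the product of the stages modulo the
    families that vanish from some earlier stage on, in which the earlier stages
    embed by sending x to the germ of its images.

    Conversely let M be an RD-submodule of V and b in V.  A Skolem hull N of b,
    of size bounded in terms of the ring, can be taken so that the intersection
    of M and N is RD in N and M + N is again RD in V ([RD_hull], [RD_enlarge]).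
    Since M + N is the pushout of M and N along their intersection, the
    inclusion of M in M + N is a pushout of a generator.  Starting from the
    image of an RD-embedding f : A -> B, running through a well-ordering of B
    and taking unions at limits, one exhausts B by such steps, so that f is, up
    to isomorphism, a transfinite composition of pushouts of generators. *)

(** * Linear maps and modules *)

(** Maps out of a sum or a union of submodules are given on representatives.
    That the value does not depend on the representative needs to be checked
    only at 0, because the relation is linear. *)
Lemma linear_of_graph (R : pzRingType) (V W : lmodType R) (P : V -> W -> Prop) :
    (forall x, exists y, P x y) ->
    (forall y, P 0 y -> y = 0) ->
    (forall r x x' y y', P x y -> P x' y' ->
       P (r *: x + x') (r *: y + y')) ->
  exists g : {linear V -> W}, forall x y, P x y <-> g x = y.
Proof.
move=> tot P0 Plin.
have Pfun x y y' : P x y -> P x y' -> y = y'.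
  move=> Pxy Pxy'; have := Plin (-1) _ _ _ _ Pxy Pxy'.
  by rewrite !scaleN1r addNr => /P0; rewrite addrC => /subr0_eq.
have [g gP] := choice tot.
have g_lin : linear g.
  by move=> r x y; apply: Pfun (gP _) _; apply: Plin.
pose G : {linear V -> W} :=
  HB.pack g (GRing.isLinear.Build _ _ _ _ g g_lin).
exists G => x y; split=> [|<-]; last exact: gP.
exact/Pfun/gP.
Qed.

Section Submodules.
Context (R : pzRingType) (V : lmodType R).

Record submod := Submod {
  sub_set :> V -> Prop;
  sub0 : sub_set 0;
  subZD : forall r x y, sub_set x -> sub_set y -> sub_set (r *: x + y) }.

Implicit Types S T : submod.

Lemma subZ S r x : S x -> S (r *: x).
Proof.
by move=> Sx; rewrite -[r *: x]addr0; apply: subZD => //; apply: sub0.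
Qed.

Lemma subD S x y : S x -> S y -> S (x + y).
Proof. by move=> Sx Sy; rewrite -[x]scale1r; apply: subZD. Qed.

Lemma subB S x y : S x -> S y -> S (x - y).
Proof. by move=> Sx Sy; rewrite addrC -scaleN1r; apply: subZD. Qed.

Definition mem_submod S : {pred V} := fun x => `[< S x >].

Lemma mem_submodP S x : reflect (S x) (x \in mem_submod S).
Proof. exact: asboolP. Qed.

Fact mem_submod_closed S : subsemimod_closed (mem_submod S).
Proof.
split; last by move=> r x /mem_submodP Sx; apply/mem_submodP/subZ.
split; first exact/mem_submodP/sub0.
by move=> x y /mem_submodP Sx /mem_submodP Sy; apply/mem_submodP/subD.
Qed.

HB.instance Definition _ S :=
  GRing.isSubmodClosed.Build R V (mem_submod S) (mem_submod_closed S).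

(* The subtype is given a name so that the module structure can be attached to
   it rather than to all sigma types. *)
Definition submod_type S := {x : V | x \in mem_submod S}.

HB.instance Definition _ S := SubType.on (submod_type S).
HB.instance Definition _ S := [Choice of submod_type S by <:].
HB.instance Definition _ S :=
  [SubChoice_isSubLmodule of submod_type S by <:].

Definition submod_mod S : lmodType R := submod_type S.

Definition emb S : {linear submod_mod S -> V} :=
  (val : submod_type S -> V).

Definition in_sub S x (Sx : S x) : submod_mod S :=
  Sub x (introT (mem_submodP S x) Sx).

Arguments emb : simpl never.

Lemma emb_inj S : injective (emb S).
Proof. exact: val_inj. Qed.

Lemma embP S (x : submod_mod S) : S (emb S x).
Proof. exact/mem_submodP/valP. Qed.

Lemma in_subK S x (Sx : S x) : emb S (in_sub Sx) = x.
Proof. exact: SubK. Qed.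

Definition incl_fun S T (ST : S `<=` T) (x : submod_mod S) : submod_mod T :=
  in_sub (ST _ (embP x)).

Fact incl_linear S T (ST : S `<=` T) : linear (incl_fun ST).
Proof.
move=> r x y; apply: emb_inj.
by rewrite [RHS]linearP /incl_fun !in_subK linearP.
Qed.

HB.instance Definition _ S T (ST : S `<=` T) :=
  GRing.isLinear.Build R _ _ _ (incl_fun ST) (incl_linear ST).

Definition incl S T (ST : S `<=` T) : {linear submod_mod S -> submod_mod T} :=
  incl_fun ST.

Arguments incl : simpl never.

Lemma emb_incl S T (ST : S `<=` T) x : emb T (incl ST x) = emb S x.
Proof. exact: in_subK. Qed.

Definition quot_type S := Quotient.quot (mem_submod S).
HB.instance Definition _ S := GRing.Zmodule.on (quot_type S).

Definition qpi S (x : V) : quot_type S := \pi x.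

Lemma qpiP S x y : qpi S x = qpi S y <-> S (x - y).
Proof.
rewrite /qpi; split=> [/eqP|Sxy].
  by rewrite piE Quotient.equivE => /mem_submodP.
by apply/eqP; rewrite piE Quotient.equivE; apply/mem_submodP.
Qed.

Lemma qpi_surj S (z : quot_type S) : exists x, qpi S x = z.
Proof. by exists (repr z); rewrite /qpi reprK. Qed.

Lemma qpiD S x y : qpi S (x + y) = qpi S x + qpi S y.
Proof. by rewrite /qpi piE. Qed.

Definition qscale S r (z : quot_type S) : quot_type S := qpi S (r *: repr z).

Lemma qpiZ S r x : qpi S (r *: x) = qscale r (qpi S x).
Proof.
apply/qpiP; rewrite -scalerBr; apply: subZ; apply/qpiP.
by rewrite /qpi reprK.
Qed.

Fact qscaleA S a b (v : quot_type S) :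
  qscale a (qscale b v) = qscale (a * b) v.
Proof. by have [x <-] := qpi_surj v; rewrite -!qpiZ scalerA. Qed.

Fact qscale1 S : left_id 1 (@qscale S).
Proof. by move=> v; have [x <-] := qpi_surj v; rewrite -!qpiZ scale1r. Qed.

Fact qscaleDr S : right_distributive (@qscale S) +%R.
Proof.
move=> r u v; have [[x <-] [y <-]] := (qpi_surj u, qpi_surj v).
by rewrite -qpiD -!qpiZ scalerDr qpiD.
Qed.

Fact qscaleDl S (v : quot_type S) :
  {morph (@qscale S)^~ v : a b / a + b}.
Proof.
by move=> a b; have [x <-] := qpi_surj v; rewrite -!qpiZ scalerDl qpiD.
Qed.

HB.instance Definition _ S := GRing.Zmodule_isLmodule.Build R (quot_type S)
  (@qscaleA S) (@qscale1 S) (@qscaleDr S) (@qscaleDl S).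

Definition quot_mod S : lmodType R := quot_type S.

Fact qpi_linear S : linear (qpi S : V -> quot_mod S).
Proof. by move=> r x y; rewrite qpiD qpiZ. Qed.

HB.instance Definition _ S :=
  GRing.isLinear.Build R V (quot_mod S) _ (qpi S) (qpi_linear S).

Lemma qpi_scale S r x : r *: (qpi S x : quot_mod S) = qpi S (r *: x).
Proof. by rewrite qpiZ. Qed.

Definition quot_map S : {linear V -> quot_mod S} := qpi S.

End Submodules.

Section Product.
Context (R : pzRingType) (J : small) (M : J -> lmodType R).

Definition prod_type := forall j, M j.
HB.instance Definition _ := Choice.on prod_type.

Implicit Types x y z : prod_type.

Definition prod_add x y : prod_type := fun j => x j + y j.
Definition prod_opp x : prod_type := fun j => - x j.
Definition prod_zero : prod_type := fun j => 0.
Definition prod_scale r x : prod_type := fun j => r *: x j.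

Lemma prod_ext x y : (forall j, x j = y j) -> x = y.
Proof. exact: functional_extensionality_dep. Qed.

Fact prod_addA : associative prod_add.
Proof. by move=> x y z; apply/prod_ext => j; apply: addrA. Qed.
Fact prod_addC : commutative prod_add.
Proof. by move=> x y; apply/prod_ext => j; apply: addrC. Qed.
Fact prod_add0 : left_id prod_zero prod_add.
Proof. by move=> x; apply/prod_ext => j; apply: add0r. Qed.
Fact prod_addN : left_inverse prod_zero prod_opp prod_add.
Proof. by move=> x; apply/prod_ext => j; apply: addNr. Qed.

HB.instance Definition _ :=
  GRing.isZmodule.Build prod_type prod_addA prod_addC prod_add0 prod_addN.

Fact prod_scaleA a b x : prod_scale a (prod_scale b x) = prod_scale (a * b) x.
Proof. by apply/prod_ext => j; apply: scalerA. Qed.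
Fact prod_scale1 : left_id 1 prod_scale.
Proof. by move=> x; apply/prod_ext => j; apply: scale1r. Qed.
Fact prod_scaleDr : right_distributive prod_scale +%R.
Proof. by move=> r x y; apply/prod_ext => j; apply: scalerDr. Qed.
Fact prod_scaleDl x : {morph prod_scale^~ x : a b / a + b}.
Proof. by move=> a b; apply/prod_ext => j; apply: scalerDl. Qed.

HB.instance Definition _ := GRing.Zmodule_isLmodule.Build R prod_type
  prod_scaleA prod_scale1 prod_scaleDr prod_scaleDl.

Definition prod_mod : lmodType R := prod_type.

End Product.

(** * Closure properties of RD-embeddings *)

Section RDClosure.
Context (R : pzRingType).

Definition reflects_divisibility (A B : lmodType R)
    (f : {linear A -> B}) : Prop :=
  forall r a b, f a = r *: b -> exists a', a = r *: a'.

(** Injectivity turns the equation f a = r *: f a' into a = r *: a', which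
    eliminates the image of f from the condition. *)
Lemma RD_embeddingP (A B : lmodType R) (f : {linear A -> B}) :
  RD_embedding (Arrow f) <-> injective f /\ reflects_divisibility f.
Proof.
split=> -[f_inj RDf]; split=> //.
- move=> r a b fab; have : (range f `&` [set r *: b | b in setT]) (f a).
    by split; [exists a | exists b].
  rewrite RDf => -[_ [a' _ <-] /=]; rewrite -linearZ /= => /f_inj <-.
  by exists a'.
- move=> r; apply/seteqP; split=> [_ [[a _ <-] [b _ /esym/RDf [a' ->]]]|].
    by exists (f a'); [exists a' | rewrite linearZ].
  move=> _ [_ [a _ <-] <-]; split; last by exists (f a).
  by exists (r *: a); rewrite ?linearZ.
Qed.

(** If f a = r *: b then wf a = r *: w b, and divisibility of a by r is a
    statement about the common domain of f and wf. *)
Lemma RD_cancel (A B C : lmodType R) (f : {linear A -> B})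
    (w : {linear B -> C}) (wf : {linear A -> C}) :
  w \o f =1 wf -> RD_embedding (Arrow wf) -> RD_embedding (Arrow f).
Proof.
move=> wfE /RD_embeddingP [wf_inj RDwf]; apply/RD_embeddingP; split.
  by move=> x y fxy; apply: wf_inj; rewrite -!wfE /= fxy.
move=> r a b fab; apply: (RDwf _ _ (w b)).
by rewrite -wfE /= fab linearZ.
Qed.

Lemma RD_id (A : lmodType R) (f : {linear A -> A}) :
  f =1 id -> RD_embedding (Arrow f).
Proof.
move=> fE; apply/RD_embeddingP; split; first by move=> x y; rewrite !fE.
by move=> r a b; rewrite fE; exists b.
Qed.

Lemma RD_comp (A B C : lmodType R) (f : {linear A -> B}) (g : {linear B -> C})
    (gf : {linear A -> C}) :
  g \o f =1 gf -> RD_embedding (Arrow f) -> RD_embedding (Arrow g) ->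
  RD_embedding (Arrow gf).
Proof.
move=> gfE /RD_embeddingP [f_inj RDf] /RD_embeddingP [g_inj RDg].
apply/RD_embeddingP; split.
  by move=> x y; rewrite -!gfE /= => /g_inj/f_inj.
by move=> r a c; rewrite -gfE /= => /RDg [b /RDf].
Qed.

Lemma RD_closed_retract : closed_retract (@RD_embedding R).
Proof.
move=> [A B f] [C D g] [i [p [j [q [/= pi1 qj1 gi fp]]]]].
move=> /RD_embeddingP [g_inj RDg]; apply/RD_embeddingP; split.
  move=> x y fxy; rewrite -[x]pi1 -[y]pi1 /=; congr (p _); apply: g_inj.
  by have := gi x; have := gi y; rewrite /= fxy => -> ->.
move=> r a b fab; have /RDg [c iac] : g (i a) = r *: j b.
  by have := gi a; rewrite /= fab linearZ.
by exists (p c); rewrite -linearZ -iac; apply/esym/pi1.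
Qed.

(** The cocone tested is (B * C) / {(f a, - g a)}.  If (0, c) and s *: (b, c')
    agree there, their difference is (f a, - g a) with f a = s *: (- b), so that
    a = s *: a' and c = s *: (c' - g a'). *)
Lemma RD_closed_pushout : closed_pushout (@RD_embedding R).
Proof.
move=> A B C D f g h k [hfkg po] /RD_embeddingP [f_inj RDf].
pose glue : set (B * C) := [set z | exists a, z = (f a, - g a)].
have glue0 : glue 0 by exists 0; rewrite [f 0]linear0 [g 0]linear0 oppr0.
have glueZD r x y : glue x -> glue y -> glue (r *: x + y).
  move=> [a ->] [b ->]; exists (r *: a + b).
  by rewrite [f (_ + _)]linearP [g (_ + _)]linearP opprD -scalerN.
pose S := Submod glue0 glueZD.
pose l_fun (b : B) : (B * C)%type := (b, 0).
pose r_fun (c : C) : (B * C)%type := (0, c).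
have l_lin : linear l_fun.
  by move=> a x y; rewrite /l_fun; congr pair; rewrite /= scaler0 addr0.
have r_lin : linear r_fun.
  by move=> a x y; rewrite /r_fun; congr pair; rewrite /= scaler0 addr0.
pose l : {linear B -> (B * C)%type} :=
  HB.pack l_fun (GRing.isLinear.Build _ _ _ _ l_fun l_lin).
pose r : {linear C -> (B * C)%type} :=
  HB.pack r_fun (GRing.isLinear.Build _ _ _ _ r_fun r_lin).
pose u : {linear B -> quot_mod S} := quot_map S \o l.
pose v : {linear C -> quot_mod S} := quot_map S \o r.
have [a|w [_ wk] _] := po _ u v.
  apply/qpiP; exists a; rewrite /l_fun /r_fun.
  by congr pair; rewrite /= ?subr0 ?sub0r.
apply: (RD_cancel wk); apply/RD_embeddingP; split.
  move=> x y /qpiP [a [/esym fa0 xy]]; apply: subr0_eq; rewrite xy.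
  suff -> : a = 0 by rewrite linear0 oppr0.
  by apply: f_inj; rewrite fa0 linear0 subr0.
move=> s c z; have [[b c'] <-] := qpi_surj z; rewrite qpi_scale.
move=> /qpiP [a [/= fa ga]]; have [a' aE] : exists a', a = s *: a'.
  by apply: (RDf _ _ (- b)); rewrite -fa sub0r scalerN.
exists (c' - g a'); rewrite scalerBr -linearZ -aE.
by rewrite -ga addrC subrK.
Qed.

End RDClosure.

(** * Well-orders *)

Section WellOrder.
Context (J : small) (le : rel J).
Hypothesis le_wo : well_order le.

Lemma wo_pick (P : set J) : P !=set0 ->
  exists2 i, P i & forall j, P j -> le i j.
Proof.
move=> [x Px].
have [|i [[/asboolP Pi lei] _]] := le_wo (A := fun i => `[< P i >]).
  by exists x; apply/asboolP.
by exists i => // j Pj; apply: lei; apply/asboolP.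
Qed.

Lemma wo_total i j : le i j \/ le j i.
Proof.
have [|k [->|->] kle] := @wo_pick [set k | k = i \/ k = j].
- by exists i; left.
- by left; apply: kle; right.
- by right; apply: kle; left.
Qed.

Lemma wo_refl i : le i i.
Proof. by case: (wo_total i i). Qed.

Lemma wo_anti i j : le i j -> le j i -> i = j.
Proof.
move=> ij ji; have [|m [_ mU]] := le_wo (A := fun k => `[< k = i \/ k = j >]).
  by exists i; apply/asboolP; left.
have minE k : k = i \/ k = j -> m = k.
  move=> kij; apply: mU; split; first exact/asboolP.
  by move=> l /asboolP [] ->; case: kij => ->; rewrite ?wo_refl.
by rewrite -(minE i) ?(minE j); auto.
Qed.

Lemma wo_trans j i k : le i j -> le j k -> le i k.
Proof.
move=> ij jk.
have [|m mX mle] := @wo_pick [set m | [\/ m = i, m = j | m = k]].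
  by exists i; constructor 1.
have [im jm km] : [/\ le m i, le m j & le m k].
  by split; apply: mle; [constructor 1 | constructor 2 | constructor 3].
case: mX => mE; move: im jm km; rewrite mE // => im jm km.
  by rewrite (wo_anti ij im).
by rewrite -(wo_anti jk jm).
Qed.

Lemma belowNle i j : below le i j <-> ~~ le j i.
Proof.
split=> [/andP[] //|ji]; apply/andP; split=> //.
by case: (wo_total i j) => // ji'; rewrite ji' in ji.
Qed.

Lemma wo_ltP i j : le i j \/ below le j i.
Proof.
by case: (boolP (le i j)) => [|/belowNle]; [left | right].
Qed.

Lemma le_neq_below i j : le i j -> i <> j -> below le i j.
Proof.
by move=> ij ne; rewrite /below ij; apply/negP => ji; apply/ne/wo_anti.
Qed.

Lemma wo_join i i' j : below le i j -> below le i' j ->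
  exists k, [/\ below le k j, le i k & le i' k].
Proof.
move=> ij i'j; case: (wo_total i i') => ii'.
  by exists i'; rewrite wo_refl.
by exists i; rewrite wo_refl.
Qed.

Lemma wo_ind (P : J -> Prop) :
  (forall j, (forall i, below le i j -> P i) -> P j) -> forall j, P j.
Proof.
move=> IH j; apply: contrapT => nPj.
have [|i nPi imin] := @wo_pick [set i | ~ P i]; first by exists j.
apply/nPi/IH => k /belowNle nik; apply: contrapT => /imin ik.
by rewrite ik in nik.
Qed.

End WellOrder.

(** * Transfinite compositions of RD-embeddings *)

Section RDChains.
Context (R : pzRingType) (J : small) (le : rel J) (M : chain_diagram R le).
Hypothesis le_wo : well_order le.

(** The zeros at the stages not above i keep the family total; the germ at a
    limit does not see them. *)
Definition tail_fun (i : J) (x : obj M i) : prod_mod (obj M) := fun k =>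
  if @idP (le i k) is ReflectT ik then link M ik x else 0.

Lemma tailE i x k (ik : le i k) : tail_fun x k = link M ik x.
Proof.
rewrite /tail_fun; case: {-}_ / idP => [ik'|/(_ ik)//].
by rewrite (bool_irrelevance ik' ik).
Qed.

Fact tail_linear i : linear (@tail_fun i).
Proof.
move=> r x y; apply/prod_ext => k.
change (tail_fun (r *: x + y) k = r *: tail_fun x k + tail_fun y k).
case: (boolP (le i k)) => ik; first by rewrite !tailE linearP.
have tail0 z : tail_fun (i := i) z k = 0.
  by rewrite /tail_fun; case: {-}_ / idP => // ik'; rewrite ik' in ik.
by rewrite !tail0 scaler0 addr0.
Qed.

HB.instance Definition _ i :=
  GRing.isLinear.Build R (obj M i) (prod_mod (obj M)) _
    (@tail_fun i) (@tail_linear i).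

Definition tail i : {linear obj M i -> prod_mod (obj M)} := @tail_fun i.

Section Limit.
Variables (i0 j : J).
Hypothesis i0j : below le i0 j.

Definition null : set (prod_mod (obj M)) := [set z |
  exists2 i, below le i j & forall k, le i k -> below le k j -> z k = 0].

Fact null0 : null 0.
Proof. by exists i0. Qed.

Fact nullZD r x y : null x -> null y -> null (r *: x + y).
Proof.
move=> [i ij x0] [i' i'j y0].
have [m [mj im i'm]] := wo_join le_wo ij i'j.
exists m => // k mk kj; have ik := wo_trans le_wo im mk.
have i'k := wo_trans le_wo i'm mk.
by change (r *: x k + y k = 0); rewrite x0 // y0 // scaler0 addr0.
Qed.

Definition null_sub := Submod null0 nullZD.

Definition germ i : {linear obj M i -> quot_mod null_sub} :=
  quot_map null_sub \o tail i.

(** An equation between germs holds in some stage below j, and there the link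
    from i0 is an RD-embedding. *)
Lemma RD_limit : colimit_at M j ->
    (forall k (ik : le i0 k), below le k j ->
       RD_embedding (Arrow (link M ik))) ->
  forall ij : le i0 j, RD_embedding (Arrow (link M ij)).
Proof.
move=> colim RDlink ij.
have [i k ij' kj ik x|w wc _] := colim _ (fun i _ => germ i).
  apply/qpiP; exists k => // l kl _.
  change (tail_fun (link M ik x) l - tail_fun x l = 0).
  have il := wo_trans le_wo ik kl.
  by rewrite !tailE -[link M il x](link_comp ik kl il) subrr.
apply: (RD_cancel (wc i0 i0j ij)); apply/RD_embeddingP; split.
  move=> x y /qpiP [i ij' xy].
  have [k [kj i0k ik]] := wo_join le_wo i0j ij'.
  have /RD_embeddingP [l_inj _] := RDlink k i0k kj.
  apply: l_inj; apply: subr0_eq; rewrite -!tailE.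
  exact: xy.
move=> r x z; have [y <-] := qpi_surj z; rewrite qpi_scale.
move=> /qpiP [i ij' xy].
have [k [kj i0k ik]] := wo_join le_wo i0j ij'.
have /RD_embeddingP [_ RDl] := RDlink k i0k kj.
apply: (RDl _ _ (y k)); rewrite -tailE; apply: subr0_eq.
exact: xy.
Qed.

End Limit.
End RDChains.

Lemma RD_closed_transfinite_composition (R : pzRingType) :
  closed_transfinite_composition (@RD_embedding R).
Proof.
move=> J le M bot top bot_top le_wo le_bot le_top M_smooth M_succ.
suff RDj j (bj : le bot j) : RD_embedding (Arrow (link M bj)) by [].
elim/(wo_ind le_wo): j bj => j IH bj.
have [eqj|/(le_neq_below le_wo bj) lt_bj] := pselect (bot = j).
  by case: _ / eqj bj {IH} => bb; apply/RD_id/link_id.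
have [[i [ij ij_succ]]|no_succ] := pselect (exists i, is_succ le i j).
  have lij : le i j by case/andP: ij.
  apply: (RD_comp (@link_comp _ _ _ M _ _ _ (le_bot i) lij bj)).
    exact: IH.
  exact: M_succ.
have j_lim : is_limit le j.
  by split=> [|i ij]; [exists bot | apply: no_succ; exists i].
apply: (RD_limit le_wo lt_bj (M_smooth _ j_lim)) => k bk kj.
exact: IH.
Qed.

(** * Isomorphic monomorphisms, pushouts of submodules *)

Section Factorization.
Context (R : pzRingType).

Lemma linear_factor (A B C : lmodType R) (g : {linear B -> C})
    (h : {linear A -> C}) :
  injective g -> (forall x, exists y, g y = h x) ->
  exists i : {linear A -> B}, g \o i =1 h.
Proof.
move=> g_inj gh.
have [||r x x' y y'|i iP] := @linear_of_graph R A B (fun x y => g y = h x).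
- exact: gh.
- by move=> y; rewrite linear0 -[0](linear0 g) => /g_inj.
- by rewrite !linearP => -> ->.
by exists i => x; apply/iP.
Qed.

(** For monomorphisms, an isomorphism of codomains matching the images already
    determines an isomorphism of arrows. *)
Lemma retract_of_iso (A B C D : lmodType R)
    (f : {linear A -> B}) (g : {linear C -> D})
    (j : {linear B -> D}) (q : {linear D -> B}) :
    injective f -> injective g -> cancel j q -> cancel q j ->
    (forall x, exists y, g y = j (f x)) ->
    (forall y, exists x, j (f x) = g y) ->
  is_retract (Arrow f) (Arrow g).
Proof.
move=> f_inj g_inj jK qK im_f im_g.
have [i iE] := linear_factor (h := j \o f) g_inj im_f.
have [|p pE] := linear_factor (h := q \o g) f_inj.
  by move=> y; have [x xE] := im_g y; exists x; rewrite /= -xE jK.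
exists i, p, j, q; split=> //= x.
apply: f_inj; have := pE (i x); rewrite /= => ->.
by have := iE x; rewrite /= => ->; rewrite jK.
Qed.

End Factorization.

Section RelativelyDivisible.
Context (R : pzRingType) (V : lmodType R).
Implicit Types S T U : submod V.

Definition RD_in (S T : set V) : Prop :=
  forall r x, T x -> S (r *: x) -> exists2 y, S y & r *: x = r *: y.

Lemma RD_incl S T (ST : S `<=` T) :
  RD_in S T -> RD_embedding (Arrow (incl ST)).
Proof.
move=> RDST; apply/RD_embeddingP; split.
  by move=> x y /(congr1 (emb T)); rewrite !emb_incl => /emb_inj.
move=> r a b /(congr1 (emb T)); rewrite emb_incl linearZZ => aE.
have [|y Sy yE] := RDST r _ (embP b); first by rewrite -aE; apply: embP.
by exists (in_sub Sy); apply: emb_inj; rewrite linearZZ in_subK aE.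
Qed.

Fact cap0 S T : (S `&` T) 0.
Proof. by split; apply: sub0. Qed.

Fact capZD S T r x y : (S `&` T) x -> (S `&` T) y -> (S `&` T) (r *: x + y).
Proof. by move=> [? ?] [? ?]; split; apply: subZD. Qed.

Definition cap S T := Submod (@cap0 S T) (@capZD S T).

(** A sum s + t vanishes only if s = - t lies in both summands, so maps agreeing
    on the intersection glue. *)
Lemma pushout_sum S T U (SU : S `<=` U) (TU : T `<=` U) :
    (forall x, U x -> exists s t, [/\ S s, T t & x = s + t]) ->
  is_pushout (incl (@subIsetr _ S T : cap S T `<=` T))
    (incl (@subIsetl _ S T : cap S T `<=` S)) (incl TU) (incl SU).
Proof.
move=> U_sum; split=> [x|Z u v uv].
  by apply: emb_inj; rewrite /comp !emb_incl.
pose P (x : submod_mod U) z :=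
  exists s t, emb U x = emb S s + emb T t /\ z = v s + u t.
have Ptot x : exists z, P x z.
  have [s [t [Ss Tt xE]]] := U_sum _ (embP x).
  exists (v (in_sub Ss) + u (in_sub Tt)), (in_sub Ss), (in_sub Tt).
  by rewrite !in_subK.
have [||r x x' z z'|w wP] := @linear_of_graph R _ _ P => //.
- move=> z [s [t [st ->]]].
  have sE : emb S s = - emb T t.
    by apply/eqP; rewrite -addr_eq0 -st linear0.
  have Ts : T (emb S s) by rewrite sE -linearN; apply: embP.
  pose y : submod_mod (cap S T) :=
    @in_sub _ _ (cap S T) _ (conj (embP s) Ts).
  have -> : s = incl (@subIsetl _ S T : cap S T `<=` S) y.
    by apply: emb_inj; rewrite emb_incl in_subK.
  have -> : t = - incl (@subIsetr _ S T : cap S T `<=` T) y.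
    by apply: emb_inj; rewrite linearN emb_incl in_subK sE opprK.
  by have := uv y; rewrite /comp => <-; rewrite linearN subrr.
- move=> [s [t [st ->]]] [s' [t' [st' ->]]].
  exists (r *: s + s'), (r *: t + t').
  rewrite !linearP st st' !scalerDr; split; exact: addrACA.
exists w; first split=> [t|s].
- by apply/wP; exists 0, t; rewrite emb_incl !linear0 !add0r.
- by apply/wP; exists s, 0; rewrite emb_incl !linear0 !addr0.
move=> w' w'T w'S x; have [z Pxz] := Ptot x; move/wP: (Pxz) => ->.
have [s [t [st ->]]] := Pxz.
have -> : x = incl SU s + incl TU t.
  by apply: emb_inj; rewrite linearD !emb_incl.
by rewrite linearD -(w'T t) -(w'S s).
Qed.

End RelativelyDivisible.

(** * Skolem hulls relative to an RD-submodule *)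

Section Skolem.

(** [tdiv] names witnesses that keep the intersection with M relatively
    divisible in the hull, [tlift] names witnesses of divisibility modulo M,
    which keep the sum with M relatively divisible in V.  The type depends only
    on the ring, so it bounds the size of every hull at once. *)
Inductive term (R : Type) :=
| tvar
| tadd of term R & term R
| tscale of R & term R
| tdiv of R & term R
| tlift of R & term R.

Context (R : pzRingType) (V : lmodType R) (M : set V) (b : V).

Fixpoint eval_term (t : term R) : V :=
  match t with
  | tvar => b
  | tadd s t => eval_term s + eval_term t
  | tscale r t => r *: eval_term t
  | tdiv r t => xget 0 [set y | M y /\ r *: eval_term t = r *: y]
  | tlift r t => xget 0 [set y | M (r *: y - eval_term t)]
  end.

Definition hull : set V := range eval_term.

Fact hull0 : hull 0.
Proof. by exists (tscale 0 (tvar R)) => //=; rewrite scale0r. Qed.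

Fact hullZD r x y : hull x -> hull y -> hull (r *: x + y).
Proof. by move=> [s _ <-] [t _ <-]; exists (tadd (tscale r s) t). Qed.

Definition hull_sub := Submod hull0 hullZD.

Lemma hull_gen : hull b.
Proof. by exists (tvar R). Qed.

Definition enlarge : set V :=
  [set x | exists y z, [/\ M y, hull z & x = y + z]].

(** If r *: x lies in M for x in the hull, [tdiv] provides an element of both
    with the same multiple. *)
Lemma RD_hull : RD_in M setT -> RD_in (M `&` hull) hull.
Proof.
move=> RDM r _ [t _ <-] [/RDM [//|y My yE] _].
have [] := @xgetPex _ 0 [set y | M y /\ r *: eval_term t = r *: y].
  by exists y.
move=> Mz zE; exists (eval_term (tdiv r t)) => //.
by split=> //; exists (tdiv r t).
Qed.

End Skolem.

Section Enlarge.
Context (R : pzRingType) (V : lmodType R).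

Definition RD_submod (S : set V) : Prop :=
  exists2 S' : submod V, S = S' & RD_in S setT.

Lemma sub_enlarge (M : set V) b : M `<=` enlarge M b.
Proof.
by move=> x Mx; exists x, 0; split; rewrite ?addr0 //; apply: hull0.
Qed.

Lemma hull_enlarge (M : submod V) b : hull M b `<=` enlarge M b.
Proof.
by move=> x hx; exists 0, x; split; rewrite ?add0r //; apply: sub0.
Qed.

(** Let r *: x = m + n with n in the hull.  Then n is divisible by r modulo M,
    so [tlift] gives y in the hull with r *: y - n in M.  Hence r *: (x - y) is
    in M, equal to r *: m' with m' in M as M is relatively divisible, and m' + y
    is the element required. *)
Lemma RD_enlarge (M : set V) b : RD_submod M -> RD_submod (enlarge M b).
Proof.
move=> [M' -> RDM] {M}; set M := M' in RDM *.
have e0 : enlarge M b 0 by apply: sub_enlarge; apply: sub0.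
have eZD r x y : enlarge M b x -> enlarge M b y -> enlarge M b (r *: x + y).
  move=> [m [n [Mm hn ->]]] [m' [n' [Mm' hn' ->]]].
  exists (r *: m + m'), (r *: n + n'); split; first exact: subZD.
    exact: hullZD.
  by rewrite scalerDr addrACA.
exists (Submod e0 eZD) => // r x _ [m [_ [Mm [t _ <-] xE]]].
have My : M (r *: eval_term M b (tlift r t) - eval_term M b t).
  apply: (@xgetPex _ 0 [set y | M (r *: y - eval_term M b t)]).
  by exists x; rewrite /= xE addrK.
set y := eval_term _ _ (tlift r t) in My.
have [//||m' Mm' m'E] := RDM r (x - y).
  rewrite scalerBr xE.
  suff -> : m + eval_term M b t - r *: y = m - (r *: y - eval_term M b t).
    exact: subB.
  by rewrite opprB addrA.
exists (m' + y); last by rewrite scalerDr -m'E scalerBr subrK.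
by exists m', y; split=> //; exists (tlift r t).
Qed.

End Enlarge.

Lemma RD_range (R : pzRingType) (A B : lmodType R) (f : {linear A -> B}) :
  reflects_divisibility f -> RD_submod (range f).
Proof.
move=> RDf; have im0 : range f 0 by exists 0; rewrite ?linear0.
have imZD r x y : range f x -> range f y -> range f (r *: x + y).
  by move=> [a _ <-] [b _ <-]; exists (r *: a + b); rewrite ?linearP.
exists (Submod im0 imZD) => // r x _ [a _ ax].
have [a' aE] := RDf _ _ _ ax.
by exists (f a'); [exists a' | rewrite -linearZZ -aE].
Qed.

(** * Transfinite towers *)

Section Tower.
Context (T : Type) (J : small) (le : rel J).
Hypothesis le_wo : well_order le.
Context (base : set T) (step : J -> set T -> set T).

Lemma below_wf : well_founded (fun i j => is_true (below le i j)).
Proof. by apply: (wo_ind le_wo) => j IH; constructor. Qed.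

(** One clause covers all three kinds of index: for extensive steps it gives the
    base at the least index, the step at successors and the union at limits. *)
Definition tower : J -> set T := Fix below_wf (fun=> set T) (fun j rec =>
  base `|` [set x | exists i (ij : below le i j), step i (rec i ij) x]).

Lemma towerE j :
  tower j = base `|` [set x | exists2 i, below le i j & step i (tower i) x].
Proof.
rewrite /tower Fix_eq -/tower => [|k f g fg].
  congr setU; apply/seteqP; split=> x; first by move=> [i [ij ?]]; exists i.
  by move=> [i ij ?]; exists i, ij.
congr setU; apply/seteqP; split=> x [i [ij ?]]; exists i, ij.
  by rewrite -fg.
by rewrite fg.
Qed.

Hypothesis sub_step : forall i S, S `<=` step i S.

Lemma base_tower j : base `<=` tower j.
Proof. by move=> x bx; rewrite towerE; left. Qed.

Lemma step_tower i j : below le i j -> step i (tower i) `<=` tower j.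
Proof. by move=> ij x sx; rewrite [tower j]towerE; right; exists i. Qed.

Lemma tower_mono i j : le i j -> tower i `<=` tower j.
Proof.
move=> ij; have [->//|/(le_neq_below le_wo ij) ij'] := pselect (i = j).
by apply: subset_trans (step_tower ij'); apply: sub_step.
Qed.

Lemma tower_bot bot : (forall i, le bot i) -> tower bot = base.
Proof.
move=> bot_le; rewrite towerE; apply/seteqP; split=> x; last by left.
by case=> // -[i /(belowNle le_wo)]; rewrite bot_le.
Qed.

Lemma tower_succ i j : is_succ le i j -> tower j = step i (tower i).
Proof.
move=> [ij ij_succ]; apply/seteqP; split; last exact: step_tower.
move=> x; rewrite [tower j]towerE => -[bx|[k kj kx]].
  exact/sub_step/base_tower.
have [ki|ik] := wo_ltP le_wo k i; last by case: (ij_succ k).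
have [<-//|/(le_neq_below le_wo ki) ki'] := pselect (k = i).
by apply: sub_step; apply: step_tower kx.
Qed.

Lemma tower_limit j x : is_limit le j -> tower j x ->
  exists2 i, below le i j & tower i x.
Proof.
move=> [[i ij] j_lim]; rewrite towerE => -[bx|[k kj kx]].
  by exists i => //; apply: base_tower.
have [l [kl lj]] : exists l, below le k l /\ below le l j.
  apply: contrapT => nl; apply: (j_lim k); split=> // l klj.
  by apply: nl; exists l.
by exists l => //; apply: step_tower kx.
Qed.

(** A stage is the union of a chain of sets, each of which is the base or the
    result of an earlier step. *)
Lemma tower_pair (P : set T -> Prop) j x y :
    P base -> (forall i, below le i j -> P (step i (tower i))) ->
    tower j x -> tower j y ->
  exists S, [/\ P S, S `<=` tower j, S x & S y].
Proof.
move=> Pbase Pstep jx jy.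
have base_step i : base `<=` step i (tower i).
  by apply: subset_trans (@sub_step _ _); apply: base_tower.
have pick z : tower j z ->
    base z \/ exists2 i, below le i j & step i (tower i) z.
  by rewrite towerE.
have mono i k : le i k -> step i (tower i) `<=` step k (tower k).
  move=> ik; have [->//|/(le_neq_below le_wo ik) ik'] := pselect (i = k).
  by apply: subset_trans (@sub_step _ _); apply: step_tower.
have [bx|[i ij ix]] := pick _ jx; have [yb|[k kj ky]] := pick _ jy.
- by exists base; split=> //; apply: base_tower.
- exists (step k (tower k)); split=> //; first exact: Pstep.
    exact: step_tower.
  exact: base_step.
- exists (step i (tower i)); split=> //; first exact: Pstep.
    exact: step_tower.
  exact: base_step.
- have [ik|ki] := wo_total le_wo i k.
    exists (step k (tower k)); split=> //; first exact: Pstep.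
      exact: step_tower.
    exact: mono ix.
  exists (step i (tower i)); split=> //; first exact: Pstep.
    exact: step_tower.
  exact: mono ky.
Qed.

End Tower.

(** * Chains of submodules as diagrams *)

Section SubmoduleChain.
Context (R : pzRingType) (V : lmodType R) (J : small) (le : rel J).
Hypothesis le_wo : well_order le.
Context (S : J -> submod V).
Hypothesis S_mono : forall i j, le i j -> S i `<=` S j.

Definition sub_obj j := submod_mod (S j).
Definition sub_link i j (ij : le i j) : {linear sub_obj i -> sub_obj j} :=
  incl (S_mono ij).

Fact sub_link_id i (ii : le i i) : sub_link ii =1 id.
Proof. by move=> x; apply: emb_inj; rewrite emb_incl. Qed.

Fact sub_link_comp i j k (ij : le i j) (jk : le j k) (ik : le i k) :
  sub_link jk \o sub_link ij =1 sub_link ik.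
Proof. by move=> x; apply: emb_inj; rewrite /comp !emb_incl. Qed.

Definition sub_chain := ChainDiagram sub_link_id sub_link_comp.

Lemma sub_chain_smooth :
    (forall j x, is_limit le j -> S j x -> exists2 i, below le i j & S i x) ->
  smooth sub_chain.
Proof.
move=> S_limit j j_lim Z c c_compat.
pose P (x : sub_obj j) z := exists i (ij : below le i j) (y : sub_obj i),
  emb _ y = emb _ x /\ z = c i ij y.
have Ptot x : exists z, P x z.
  have [i ij Six] := S_limit _ _ j_lim (embP x).
  exists (c i ij (in_sub Six)), i, ij, (in_sub Six).
  by rewrite in_subK.
have lift i k (ij : below le i j) (kj : below le k j) (ik : le i k) y :
    c i ij y = c k kj (sub_link ik y).
  exact/esym/(c_compat i k ij kj ik).
have [||r x x' z z'|w wP] := @linear_of_graph R _ _ P => //.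
- move=> z [i [ij [y [y0 ->]]]].
  suff -> : y = 0 by rewrite linear0.
  by apply: emb_inj; rewrite y0 !linear0.
- move=> [i [ij [y [yE ->]]]] [k [kj [y' [yE' ->]]]].
  have [ik|ki] := wo_total le_wo i k.
    rewrite (lift _ _ ij kj ik); exists k, kj, (r *: sub_link ik y + y').
    by rewrite !linearP emb_incl yE yE'.
  rewrite (lift _ _ kj ij ki); exists i, ij, (r *: y + sub_link ki y').
  by rewrite !linearP emb_incl yE yE'.
exists w => [i ij ij' y|w' w'c x].
  by apply/wP; exists i, ij, y; rewrite emb_incl.
have [z Pxz] := Ptot x; move/wP: (Pxz) => ->.
have [i [ij [y [yx ->]]]] := Pxz.
have ij' : le i j by case/andP: ij.
rewrite -(w'c i ij ij' y); congr (w' _).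
by apply: emb_inj; rewrite emb_incl yx.
Qed.

End SubmoduleChain.

(** * The generating set *)

Section Codes.
Context (R : pzRingType).

(** A code records, for an arrow whose codomain is covered by terms, which terms
    have the same value and which have their value in the image.  The ascription
    to [small] is the point: codes form a set. *)
Definition code : small :=
  ((term R -> term R -> Prop) * (term R -> Prop))%type.

Definition is_eval (V : lmodType R) (e : term R -> V) : Prop :=
  [/\ forall y, exists t, e t = y,
      forall s t, e (tadd s t) = e s + e t &
      forall r t, e (tscale r t) = r *: e t].

Definition coded_by (c : code) (f : arrow R) : Prop :=
  exists2 e : term R -> cod f, is_eval e &
    (forall s t, c.1 s t <-> e s = e t) /\
    (forall t, c.2 t <-> exists x, f x = e t).

Lemma eval_coded (f : arrow R) (e : term R -> cod f) :
  is_eval e -> exists c, coded_by c f.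
Proof.
move=> eP; exists (fun s t => e s = e t, fun t => exists x, f x = e t).
by exists e.
Qed.

Lemma eval_map (V W : lmodType R) (e : term R -> V) (e' : term R -> W) :
    is_eval e -> is_eval e' -> (forall s t, e s = e t -> e' s = e' t) ->
  exists j : {linear V -> W}, forall t, j (e t) = e' t.
Proof.
move=> [e_surj eD eZ] [_ eD' eZ'] ee'.
pose P x y := exists2 t, e t = x & e' t = y.
have [x|y|r x x' y y'|j jP] := @linear_of_graph R _ _ P.
- by have [t <-] := e_surj x; exists (e' t), t.
- move=> [t t0 <-]; have -> : e' t = e' (tscale 0 t).
    by apply: ee'; rewrite eZ scale0r.
  by rewrite eZ' scale0r.
- move=> [t <- <-] [t' <- <-]; exists (tadd (tscale r t) t').
    by rewrite eD eZ.
  by rewrite eD' eZ'.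
by exists j => t; apply/jP; exists t.
Qed.

(** The addition and the scaling of the codomain can be read off the terms, so a
    code determines a monomorphism up to isomorphism. *)
Lemma coded_retract c (f g : arrow R) :
    injective f -> injective g -> coded_by c f -> coded_by c g ->
  is_retract f g.
Proof.
case: f g => A B f [C D g] /= f_inj g_inj.
move=> [/= e eP [c1 c2]] [/= e' eP' [c1' c2']].
have [|j jE] := eval_map eP eP'; first by move=> s t /c1/c1'.
have [|q qE] := eval_map eP' eP; first by move=> s t /c1'/c1.
have [e_surj _ _] := eP; have [e_surj' _ _] := eP'.
apply: (@retract_of_iso _ _ _ _ _ f g j q) => //.
- by move=> y; have [t <-] := e_surj y; rewrite jE qE.
- by move=> y; have [t <-] := e_surj' y; rewrite qE jE.
- move=> x; have [t tE] := e_surj (f x).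
  by rewrite -tE jE; apply/c2'/c2; exists x.
- move=> y; have [t tE] := e_surj' (g y).
  have /c2 [x xE] : c.2 t by apply/c2'; exists y.
  by exists x; rewrite xE jE.
Qed.

Definition realized : small :=
  {c : code | exists2 f : arrow R, RD_embedding f & coded_by c f}.

Definition realize (c : realized) : arrow R := sval (cid2 (svalP c)).

Definition coded_RD : morphism_class R := fun f => exists c, realize c = f.

Lemma coded_RD_RD f : coded_RD f -> RD_embedding f.
Proof. by move=> [c <-]; rewrite /realize; case: cid2. Qed.

Lemma generated_coded (K : morphism_class R) c (f : arrow R) :
    (forall g, coded_RD g -> K g) -> closed_retract K ->
    RD_embedding f -> coded_by c f ->
  K f.
Proof.
move=> KX K_retract RDf f_code.
have c_real : exists2 f, RD_embedding f & coded_by c f by exists f.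
pose C : realized := exist _ c c_real.
have [RDg g_code] : RD_embedding (realize C) /\ coded_by c (realize C).
  by rewrite /realize; case: cid2.
apply: K_retract (KX _ (ex_intro _ C erefl)).
exact: coded_retract RDf.1 RDg.1 f_code g_code.
Qed.

End Codes.

(** * Generating all RD-embeddings *)

(* Arbitrary transfinite compositions are indexed by well-orders with a greatest
   element, which a well-ordering of the codomain may lack. *)
Section AddTop.
Context (T : eqType) (le : rel T).

Definition add_top : rel (option T) := fun x y =>
  match x, y with
  | _, None => true
  | None, Some _ => false
  | Some a, Some b => le a b
  end.

Lemma add_top_wo : well_order le -> well_order add_top.
Proof.
move=> le_wo; apply: antisymmetric_well_order.
  move=> [a|] [b|] //= /andP[ab ba].
  by congr Some; apply: wo_anti ab ba.
move=> X [x Xx]; have [[a Xa]|noX] := pselect (exists a, Some a \in X).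
  have [|m Xm m_min] := @wo_pick _ _ le_wo [set a | Some a \in X].
    by exists a.
  by exists (Some m); split=> // -[b|] // Xb; apply: m_min.
exists None; split=> [|[b|] // Xb]; last by case: noX; exists b.
by case: x Xx => // a Xa; case: noX; exists a.
Qed.

End AddTop.

Section Generation.
Context (R : pzRingType) (K : morphism_class R).
Hypotheses (K_coded : forall g, coded_RD g -> K g)
  (K_pushout : closed_pushout K) (K_retract : closed_retract K)
  (K_comp : closed_transfinite_composition K).

(** The square of M and the hull of b over their intersection is a pushout, and
    its upper side has a code because the terms cover the hull. *)
Lemma enlarge_in_class (B : lmodType R) (M U : submod B) b (MU : M `<=` U) :
    RD_in M setT -> enlarge M b = U -> K (Arrow (incl MU)).
Proof.
move=> RDM UE; pose N := hull_sub M b.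
have NU : N `<=` U by rewrite -UE; apply: hull_enlarge.
apply: (K_pushout (@pushout_sum _ _ M N U MU NU _)).
  by move=> x; rewrite -UE => -[y [z]]; exists y, z.
pose e t : submod_mod N :=
  @in_sub _ _ N (eval_term M b t) (imageT (eval_term M b) t).
have [|c c_code] := @eval_coded _
    (Arrow (incl (@subIsetr _ M N : cap M N `<=` N))) e.
  split=> [y|s t|r t].
  - have [t _ ty] := embP y; exists t; apply: emb_inj.
    by rewrite in_subK.
  - by apply: emb_inj; rewrite linearD !in_subK.
  - by apply: emb_inj; rewrite linearZZ !in_subK.
apply: (generated_coded K_coded K_retract) c_code.
exact/RD_incl/RD_hull.
Qed.

(** The tower over the image of f enlarges by the element b at stage b, so its
    top stage contains every b; f differs from the composite of the tower only
    by isomorphisms at both ends. *)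
Lemma RD_in_class (f : arrow R) : RD_embedding f -> K f.
Proof.
case: f => A B f /RD_embeddingP [f_inj RDf].
have [le0 le0_wo] := well_ordering_principle B.
pose le := add_top le0; have le_wo : well_order le := add_top_wo le0_wo.
(* The value at the top index is arbitrary, as nothing lies above it. *)
pose step (i : option B) (S : set B) := if i is Some b then enlarge S b else S.
pose base : set B := range f.
pose M := tower le_wo base step.
have step_ext i S : S `<=` step i S.
  by case: i => [b|] //=; apply: sub_enlarge.
have base_RD : RD_submod base by exact: RD_range.
have M_RD j : RD_submod (M j).
  elim/(wo_ind le_wo): j => j IH.
  have step_RD i : below le i j -> RD_submod (step i (M i)).
    by move=> ij; have := IH i ij; case: i {ij} => [b|] //; apply: RD_enlarge.
  have pair x y := @tower_pair _ _ _ le_wo base step step_ext _ j x y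
    base_RD step_RD.
  have M0 : M j 0 by apply: base_tower; exists 0; rewrite ?linear0.
  have MZD r x y : M j x -> M j y -> M j (r *: x + y).
    move=> Mx My; have [S [[S' -> _] SM Sx Sy]] := pair _ _ Mx My.
    exact/SM/subZD.
  exists (Submod M0 MZD) => // r x _ Mrx.
  have [S [[_ _ RDS] SM Sx _]] := pair _ _ Mrx Mrx.
  by have [y Sy ->] := RDS r x I Sx; exists y => //; apply: SM.
have /choice [S SP] : forall j, exists S : submod B,
    M j = S /\ RD_in S setT.
  by move=> j; have [S ME RDM] := M_RD j; exists S; rewrite -ME.
have S_mono i j : le i j -> S i `<=` S j.
  move=> ij; rewrite -(SP i).1 -(SP j).1; exact: tower_mono.
have [bot _ bot_le] := @wo_pick _ _ le_wo setT (ex_intro _ None I).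
have bot_top : le bot None by apply: bot_le.
have bot_le' i : le bot i by apply: bot_le.
have link_K : K (Arrow (sub_link S_mono bot_top)).
  apply: (K_comp (M := sub_chain S_mono)) => //.
  - by case.
  - apply: (sub_chain_smooth le_wo) => j x j_lim; rewrite -(SP j).1 => Mx.
    have [i ij Mix] := tower_limit j_lim Mx.
    by exists i => //; rewrite -(SP i).1.
  move=> [b|] j ij ij_succ; last first.
    by have [/andP[_ /negP nj] _] := ij_succ; case: nj; case: (j).
  apply: (@enlarge_in_class _ (S (Some b)) (S j) b).
    by case: (SP (Some b)).
  rewrite -(SP j).1 -(SP (Some b)).1.
  by rewrite /M (tower_succ le_wo base step_ext ij_succ).
have SbotE x : S bot x <-> exists a, f a = x.
  rewrite -(SP bot).1 /M tower_bot //.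
  by split=> [[a _ <-]|[a <-]]; exists a.
have S_top x : S None x.
  rewrite -(SP None).1.
  apply: (@step_tower _ _ _ le_wo base step (Some x)) => //=.
  by rewrite -/M (SP (Some x)).1; apply: hull_enlarge; apply: hull_gen.
have [|j jE] :=
    @linear_factor _ _ _ _ (emb (S None)) (@idfun B) (@emb_inj _ _ _).
  by move=> x; exists (in_sub (S_top x)); rewrite in_subK.
apply: K_retract link_K.
apply: (retract_of_iso (j := j) (q := emb (S None))) => //.
- by move=> x y /(congr1 (emb _)); rewrite !emb_incl => /emb_inj.
- by move=> x; apply: emb_inj; apply: jE.
- move=> a; have Sfa : S bot (f a) by apply/SbotE; exists a.
  exists (in_sub Sfa); apply: emb_inj; rewrite emb_incl in_subK.
  exact/esym/jE.
- move=> y; have /SbotE [a ay] := embP y; exists a; apply: emb_inj.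
  by rewrite emb_incl -ay; apply: jE.
Qed.

End Generation.

Theorem corollary3p13 (R : pzRingType) :
  cofibrantly_generated (@RD_embedding R).
Proof.
exists (@coded_RD R); split; first by exists (realized R), (@realize R).
move=> f; split=> [RDf K XK K_po K_comp K_ret|gen_f].
  exact: (RD_in_class XK K_po K_ret K_comp).
apply: gen_f.
- exact: coded_RD_RD.
- exact: RD_closed_pushout.
- exact: RD_closed_transfinite_composition.
- exact: RD_closed_retract.
Qed.
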